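(* Let $V:\mathbb{R}\to[0,\infty)$ be an optimal velocity function with safety distance $d_S\ge 0$. Let $(c^\star,h^\star)\in(0,\infty)\times(0,\infty)$ be the unique pair of positive reals with $h^\star V(c^\star)=c^\star$ and $h^\star V'(c^\star)=1$. Then, apart from $(c^\star,h^\star)$, all other solutions $(c,h)\in(0,\infty)\times(0,\infty)$ of the equation $$h\,V(c)=c$$ are given by two branches $h\mapsto(c_i(h),h)$, $i=1,2$, defined by two functions $$c_1:(h^\star,\hat h)\to(d_S,c^\star)\qquad\text{and}\qquad c_2:(h^\star,\infty)\to(c^\star,\infty),$$ where $h^\star<\hat h\le\infty$. Both $c_1$ and $c_2$ are continuously differentiable with $$c_i'(h)=\frac{V(c_i(h))}{1-h\,V'(c_i(h))},\qquad i=1,2,$$ where $h\,V'(c_1(h))>1$ for all $h$ along the first branch and, conversely, $h\,V'(c_2(h))<1$ for all $h$ along the second branch.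
   Context: A function $V:\mathbb{R}\to[0,\infty)$ is called an optimal velocity function (with safety distance $d_S$) if: (OVF 1) $V$ is non-negative and monotonically increasing (in the weak sense); (OVF 2) $V$ is bounded from above by some $V^{\max}>0$ and $\lim_{s\to\infty}V(s)=V^{\max}$; (OVF 3) there is $d_S\ge0$ such that $V(s)=0$ for all $s\le d_S$ and $V(s)>0$ for all $s>d_S$; (OVF 4) $V$ is $C^1$-smooth on $\mathbb{R}$, twice continuously differentiable in $(d_S,\infty)$, and there is a constant $b>0$ such that $V'$ is strictly increasing in $(d_S,b)$ and strictly decreasing in $(b,\infty)$. For every optimal velocity function there exists exactly one pair $(c^\star,h^\star)$ of positive reals with $h^\star V(c^\star)=c^\star$ and $h^\star V'(c^\star)=1$. *)

(* Defs.v *)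
From Stdlib Require Import Reals.
From Coquelicot Require Import Coquelicot.
Open Scope R_scope.

(** Meant for open [D] only: [ex_derive] and [continuous] are two-sided. *)
Definition C1_on (D : R -> Prop) (f : R -> R) : Prop :=
  forall x, D x -> ex_derive f x /\ continuous (Derive f) x.

Definition C2_on (D : R -> Prop) (f : R -> R) : Prop :=
  C1_on D f /\ C1_on D (Derive f).

Definition strictly_increasing_on (D : R -> Prop) (f : R -> R) : Prop :=
  forall x y, D x -> D y -> x < y -> f x < f y.

Definition strictly_decreasing_on (D : R -> Prop) (f : R -> R) : Prop :=
  forall x y, D x -> D y -> x < y -> f y < f x.

Record optimal_velocity_function (V : R -> R) (dS : R) : Prop := {
  ovf_nonneg : forall s, 0 <= V s;
  ovf_incr : forall s t, s <= t -> V s <= V t;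
  ovf_max : exists Vmax : R,
    0 < Vmax /\ (forall s, V s <= Vmax) /\ is_lim V p_infty Vmax;
  ovf_dS_nonneg : 0 <= dS;
  ovf_zero : forall s, s <= dS -> V s = 0;
  ovf_pos : forall s, dS < s -> 0 < V s;
  ovf_C1 : C1_on (fun _ => True) V;
  ovf_C2 : C2_on (fun s => dS < s) V;
  ovf_inflection : exists b : R,
    0 < b /\
    strictly_increasing_on (fun s => dS < s < b) (Derive V) /\
    strictly_decreasing_on (fun s => b < s) (Derive V)
}.

(* Main.v *)
Require Import Defs.
From Stdlib Require Import Reals Lra ClassicalEpsilon.
From Coquelicot Require Import Coquelicot.
Open Scope R_scope.

(** For [h > 0] the equation [h * V c = c] forces [V c > 0], hence [dS < c],
    and then says [h = c / V c].  So the solution set is the graph of the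
    function [time_gap V : c |-> c / V c] on [(dS, +oo)], and the branches are
    the inverses of its monotone pieces.

    The derivative of [time_gap V] has the sign of [V c - c * V' c], which is
    the height at 0 of the tangent to [V] at [c].  On [(dS, b]], where [V'] is
    strictly increasing and [V dS = 0 <= dS], the mean value theorem makes this
    height negative; on [[b, +oo)], where [V'] is strictly decreasing, the
    height is strictly increasing.  It vanishes at [cs] by the two equations
    defining [(cs, hs)], so [cs > b] and the height is negative on [(dS, cs)]
    and positive beyond [cs] ([tangent_height_neg], [tangent_height_pos]).
    Hence [time_gap V] strictly decreases on [(dS, cs]] and strictly increases
    on [[cs, +oo)], with minimum [hs] at [cs].

    It tends to [+oo] at [+oo] because [V] is bounded.  It takes arbitrarily
    large values near [dS] as well: [V] is C^1 and vanishes to the left of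
    [dS], so [V' dS = 0], and [V c] is at most [e * (c - dS) <= e * c] near
    [dS] for every [e > 0].  Both pieces are therefore onto [(hs, +oo)], so
    that the first branch lives on the same half-line as the second and
    [hhat = +oo].

    Regularity and the formula for the derivative of the branches are the
    inverse function theorem ([C1_on_inverse]): at [h = c / V c],
    [1 / (c / V c)' = (V c)^2 / (V c - c * V' c) = V c / (1 - h * V' c)]. *)

(** * Monotonicity and mean values *)

Lemma MVT_Derive (f : R -> R) (x y : R) :
  x < y -> (forall t, x <= t <= y -> ex_derive f t) ->
  exists t, x < t < y /\ f y - f x = Derive f t * (y - x).
Proof.
intros Hxy Hd.
destruct (MVT_cor2 f (Derive f) x y Hxy) as [t [Heq Ht]].
- intros t Ht. apply is_derive_Reals, Derive_correct, Hd, Ht.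
- exists t. split; assumption.
Qed.

Lemma continuous_at_left_le (f : R -> R) (x y K : R) :
  x < y -> continuous f y -> (forall t, x < t < y -> K <= f t) -> K <= f y.
Proof.
intros Hxy Hc HK.
destruct (Rle_lt_dec K (f y)) as [H|H]; [exact H|exfalso].
assert (Hn : locally y (fun t => f t < K)).
{ apply (Hc (fun z => z < K)), (open_lt K), H. }
destruct Hn as [d Hd].
set (t := Rmax ((x + y) / 2) (y - d / 2)).
assert (Hdp := cond_pos d).
assert (Ht : x < t < y /\ y - d < t).
{ unfold t, Rmax. destruct Rle_dec; lra. }
assert (Hb : f t < K).
{ apply Hd. change (Rabs (t - y) < d). apply Rabs_def1; lra. }
specialize (HK t (proj1 Ht)). lra.
Qed.

Lemma continuous_reflect (f : R -> R) (x : R) :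
  continuous f (- x) -> continuous (fun t => - f (- t)) x.
Proof.
intros Hc.
apply (continuous_opp (fun t => f (- t))).
apply (continuous_comp Ropp f).
- apply (continuous_opp (fun t : R => t)), continuous_id.
- exact Hc.
Qed.

Lemma continuous_at_right_le (f : R -> R) (x y K : R) :
  x < y -> continuous f x -> (forall t, x < t < y -> f t <= K) -> f x <= K.
Proof.
intros Hxy Hc HK.
assert (H : - K <= - f (- - x)).
{ apply (continuous_at_left_le (fun t => - f (- t)) (- y) (- x)).
  - lra.
  - apply continuous_reflect. rewrite Ropp_involutive. exact Hc.
  - intros t Ht. apply Ropp_le_contravar, HK. lra. }
rewrite Ropp_involutive in H. lra.
Qed.

(** Interposing two interior points keeps the inequality strict when passing
    to the limit at the end points. *)
Lemma strictly_increasing_on_closure (f : R -> R) (a b : R) :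
  (forall x, continuous f x) ->
  strictly_increasing_on (fun s => a < s < b) f ->
  strictly_increasing_on (fun s => a <= s <= b) f.
Proof.
intros Hc Hf x y Hx Hy Hxy.
set (u := (2 * x + y) / 3). set (v := (x + 2 * y) / 3).
assert (Huv : x < u < v /\ v < y) by (unfold u, v; lra).
assert (Hlo : f x <= f u).
{ apply (continuous_at_right_le f x u); [lra|apply Hc|].
  intros t Ht. left. apply Hf; lra. }
assert (Hhi : f v <= f y).
{ apply (continuous_at_left_le f v y); [lra|apply Hc|].
  intros t Ht. left. apply Hf; lra. }
assert (f u < f v) by (apply Hf; lra).
lra.
Qed.

Lemma strictly_decreasing_on_closure (f : R -> R) (b : R) :
  (forall x, continuous f x) ->
  strictly_decreasing_on (fun s => b < s) f ->
  strictly_decreasing_on (fun s => b <= s) f.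
Proof.
intros Hc Hf x y Hx Hy Hxy.
apply Ropp_lt_cancel.
apply (strictly_increasing_on_closure (fun t => - f t) b y); try lra.
- intros t. apply (continuous_opp f), Hc.
- intros s t Hs Ht Hst. apply Ropp_lt_contravar, Hf; lra.
Qed.

(** * Inverse functions *)

Lemma continuous_inverse_increasing (D : R -> Prop) (f g : R -> R) (y : R) :
  strictly_increasing_on D f -> locally (g y) D ->
  locally y (fun z => D (g z) /\ f (g z) = z) -> continuous g y.
Proof.
intros Hf HD Hg.
destruct (locally_singleton _ _ Hg) as [Dgy Hgy].
destruct HD as [d Hd].
intros P [e He].
set (r := Rmin d e / 2).
assert (Hr : 0 < r /\ r < d /\ r < e).
{ assert (H1 := cond_pos d). assert (H2 := cond_pos e).
  unfold r, Rmin. destruct Rle_dec; lra. }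
assert (Dlo : D (g y - r)).
{ apply Hd. change (Rabs (g y - r - g y) < d). apply Rabs_def1; lra. }
assert (Dhi : D (g y + r)).
{ apply Hd. change (Rabs (g y + r - g y) < d). apply Rabs_def1; lra. }
assert (Hlo : f (g y - r) < y) by (rewrite <- Hgy at 2; apply Hf; auto; lra).
assert (Hhi : y < f (g y + r)) by (rewrite <- Hgy at 1; apply Hf; auto; lra).
assert (L1 : locally y (fun z => f (g y - r) < z)) by apply (open_gt _ _ Hlo).
assert (L2 : locally y (fun z => z < f (g y + r))) by apply (open_lt _ _ Hhi).
unfold filtermap.
generalize (filter_and _ _ Hg (filter_and _ _ L1 L2)).
apply filter_imp. intros z [[Dz Hz] [Hz1 Hz2]].
apply He. change (Rabs (g z - g y) < e).
apply Rabs_def1.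
- destruct (Rlt_le_dec (g z) (g y + r)) as [H|[H|H]]; [lra| |].
  + assert (f (g y + r) < f (g z)) by (apply Hf; assumption). lra.
  + rewrite H in Hz2. lra.
- destruct (Rlt_le_dec (g y - r) (g z)) as [H|[H|H]]; [lra| |].
  + assert (f (g z) < f (g y - r)) by (apply Hf; assumption). lra.
  + rewrite <- H in Hz1. lra.
Qed.

Lemma continuous_inverse_decreasing (D : R -> Prop) (f g : R -> R) (y : R) :
  strictly_decreasing_on D f -> locally (g y) D ->
  locally y (fun z => D (g z) /\ f (g z) = z) -> continuous g y.
Proof.
intros Hf HD Hg.
apply continuous_ext with (fun z => - - g z); [intros; apply Ropp_involutive|].
apply (continuous_opp (fun z => - g z)).
(* [- g] inverts the increasing function [x |-> f (- x)]. *)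
apply (continuous_inverse_increasing (fun x => D (- x)) (fun x => f (- x))).
- intros x z Hx Hz Hxz. apply Hf; auto; lra.
- apply (continuous_opp (fun x : R => x) (- g y) (continuous_id _)).
  change (locally (- - g y) D). rewrite Ropp_involutive. exact HD.
- revert Hg. apply filter_imp. intros z. now rewrite Ropp_involutive.
Qed.

Lemma is_derive_inverse (f g : R -> R) (y l : R) :
  is_derive f (g y) l -> l <> 0 -> continuous g y ->
  locally y (fun z => f (g z) = z) -> is_derive g y (/ l).
Proof.
intros Hf Hl Hg Hfg.
assert (Hgy := locally_singleton _ _ Hfg). simpl in Hgy.
split; [apply is_linear_scal_l|].
intros x Hx.
assert (Ex : y = x) by now apply is_filter_lim_locally_unique.
subst x. intros eps.
assert (Hal : 0 < Rabs l) by now apply Rabs_pos_lt.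
(* The bound [|l| / 2] gives [|g z - g y| <= 2 |z - y| / |l|]; the other bound
   is what this estimate turns into [eps]. *)
assert (Hk : 0 < Rmin (Rabs l / 2) (eps * (Rabs l * Rabs l) / 2)).
{ apply Rmin_pos; [lra|].
  assert (0 < eps * (Rabs l * Rabs l)); [|lra].
  apply Rmult_lt_0_compat; [apply cond_pos|]. now apply Rmult_lt_0_compat. }
destruct Hf as [_ Hf].
specialize (Hf (g y) (fun P HP => HP) (mkposreal _ Hk)).
assert (Hf' := Hg _ Hf). unfold filtermap in Hf'.
generalize (filter_and _ _ Hfg Hf'). apply filter_imp.
intros z [Hz H].
unfold norm, minus, plus, opp, scal, mult in *; simpl in *.
unfold abs, mult in *; simpl in *.
rewrite Hz, Hgy in H.
set (w := g z + - g y) in *. set (t := z + - y) in *.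
set (k := Rmin _ _) in *.
assert (Hk1 : k <= Rabs l / 2) by apply Rmin_l.
assert (Hk2 : k <= eps * (Rabs l * Rabs l) / 2) by apply Rmin_r.
assert (Hw : Rabs l * Rabs w <= Rabs t + k * Rabs w).
{ rewrite <- Rabs_mult.
  replace (l * w) with (t - (t + - (w * l))) by ring.
  apply Rle_trans with (Rabs t + Rabs (t + - (w * l))); [|lra].
  eapply Rle_trans; [apply Rabs_triang|]. rewrite Rabs_Ropp. lra. }
assert (Hw2 : Rabs l * Rabs w <= 2 * Rabs t).
{ assert (k * Rabs w <= Rabs l / 2 * Rabs w).
  { apply Rmult_le_compat_r; [apply Rabs_pos|exact Hk1]. }
  lra. }
apply Rmult_le_reg_l with (Rabs l); [exact Hal|].
rewrite <- Rabs_mult.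
replace (l * (w + - (t * / l))) with (- (t + - (w * l))) by (field; exact Hl).
rewrite Rabs_Ropp.
apply Rle_trans with (1 := H).
apply Rle_trans with (eps * (Rabs l * Rabs l) / 2 * Rabs w).
{ apply Rmult_le_compat_r; [apply Rabs_pos|exact Hk2]. }
replace (eps * (Rabs l * Rabs l) / 2 * Rabs w)
  with (eps * Rabs l / 2 * (Rabs l * Rabs w)) by field.
replace (Rabs l * (eps * Rabs t)) with (eps * Rabs l / 2 * (2 * Rabs t))
  by field.
apply Rmult_le_compat_l; [|exact Hw2].
assert (0 < eps * Rabs l); [|lra].
apply Rmult_lt_0_compat; [apply cond_pos|exact Hal].
Qed.

Lemma C1_on_inverse (D E : R -> Prop) (f g : R -> R) :
  open D -> open E ->
  C1_on D f -> (forall x, D x -> Derive f x <> 0) ->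
  strictly_increasing_on D f \/ strictly_decreasing_on D f ->
  (forall y, E y -> D (g y) /\ f (g y) = y) ->
  C1_on E g /\ forall y, E y -> Derive g y = / Derive f (g y).
Proof.
intros OD OE Cf Nf Mf Hg.
assert (Lg : forall y, E y -> locally y (fun z => D (g z) /\ f (g z) = z)).
{ intros y Ey. generalize (OE y Ey). apply filter_imp. exact Hg. }
assert (Cg : forall y, E y -> continuous g y).
{ intros y Ey. assert (HD := OD _ (proj1 (Hg y Ey))).
  destruct Mf as [Mf|Mf].
  - exact (continuous_inverse_increasing D f g y Mf HD (Lg y Ey)).
  - exact (continuous_inverse_decreasing D f g y Mf HD (Lg y Ey)). }
assert (Dg : forall y, E y -> is_derive g y (/ Derive f (g y))).
{ intros y Ey. destruct (Hg y Ey) as [Dy _].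
  apply (is_derive_inverse f); auto.
  - apply Derive_correct, Cf, Dy.
  - generalize (Lg y Ey). apply filter_imp. tauto. }
split; [|intros y Ey; apply is_derive_unique, Dg, Ey].
intros y Ey. destruct (Hg y Ey) as [Dy _].
split; [eexists; apply Dg, Ey|].
apply continuous_ext_loc with (fun z => / Derive f (g z)).
{ generalize (OE y Ey). apply filter_imp. intros z Ez.
  symmetry. apply is_derive_unique, Dg, Ez. }
apply (continuous_comp (fun z => Derive f (g z)) Rinv).
- apply (continuous_comp g (Derive f)); [apply Cg, Ey|apply Cf, Dy].
- apply continuous_Rinv, Nf, Dy.
Qed.

(** * The tangents of an optimal velocity function *)

Section OptimalVelocity.

Variables (V : R -> R) (dS : R).
Hypothesis HV : optimal_velocity_function V dS.

Lemma ovf_ex_derive s : ex_derive V s.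
Proof. exact (proj1 (ovf_C1 _ _ HV s I)). Qed.

Lemma ovf_continuous_Derive s : continuous (Derive V) s.
Proof. exact (proj2 (ovf_C1 _ _ HV s I)). Qed.

Lemma ovf_continuous s : continuous V s.
Proof. apply (@ex_derive_continuous R_AbsRing R_NormedModule), ovf_ex_derive. Qed.

Lemma ovf_pos_inv c : 0 < V c -> dS < c.
Proof.
intros Hc. apply Rnot_le_lt. intros H.
rewrite (ovf_zero _ _ HV c H) in Hc. lra.
Qed.

Lemma ovf_Derive_nonneg s : 0 <= Derive V s.
Proof.
assert (pr : derivable V).
{ intros t. apply ex_derive_Reals_0, ovf_ex_derive. }
rewrite <- (Derive_Reals V s (pr s)).
apply nonneg_derivative_0. intros x y. apply (ovf_incr _ _ HV).
Qed.

(** The velocity attains its minimum at the safety distance. *)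
Lemma ovf_Derive_dS : Derive V dS = 0.
Proof.
assert (pr := ex_derive_Reals_0 V dS (ovf_ex_derive dS)).
rewrite <- (Derive_Reals V dS pr).
apply (deriv_minimum V (dS - 1) (dS + 1)); try lra.
intros x _ _. rewrite (ovf_zero _ _ HV dS) by lra. apply (ovf_nonneg _ _ HV).
Qed.

(** A decrease of [V'] starting at or before [dS] would make [V'] negative
    beyond [dS]. *)
Lemma ovf_inflection_gt b :
  strictly_decreasing_on (fun s => b < s) (Derive V) -> dS < b.
Proof.
intros Hdec. apply Rnot_le_lt. intros Hb.
assert (H := strictly_decreasing_on_closure _ b ovf_continuous_Derive Hdec
               dS (dS + 1)).
rewrite ovf_Derive_dS in H.
assert (H1 := ovf_Derive_nonneg (dS + 1)). lra.
Qed.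

(** The height at 0 of the tangent to [V] at [c]. *)
Definition tangent_height (c : R) : R := V c - c * Derive V c.

(** The slope of the chord from [(dS, 0)] to [(c, V c)] is [V' t] for some
    [t < c], hence below [V' c], and the chord meets the axis at [dS >= 0]. *)
Lemma tangent_height_convex b c :
  strictly_increasing_on (fun s => dS < s < b) (Derive V) ->
  dS < c <= b -> tangent_height c < 0.
Proof.
intros Hinc Hc. unfold tangent_height.
destruct (MVT_Derive V dS c) as [t [Ht Heq]].
- lra.
- intros t _. apply ovf_ex_derive.
- rewrite (ovf_zero _ _ HV dS) in Heq by lra.
  assert (Hd := ovf_dS_nonneg _ _ HV).
  assert (Hlt : Derive V t < Derive V c).
  { apply (strictly_increasing_on_closure _ dS b ovf_continuous_Derive Hinc);
      lra. }
  assert (Hn := ovf_Derive_nonneg t).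
  assert (Derive V t * (c - dS) < Derive V c * (c - dS)).
  { apply Rmult_lt_compat_r; lra. }
  assert (0 <= Derive V c * dS) by (apply Rmult_le_pos; lra).
  lra.
Qed.

(** No second derivative is involved: the chord from [x] to [y] is steeper than
    [V' y], so the height grows by more than [x * (V' x - V' y) > 0]. *)
Lemma tangent_height_concave b :
  0 < b -> strictly_decreasing_on (fun s => b < s) (Derive V) ->
  strictly_increasing_on (fun s => b <= s) tangent_height.
Proof.
intros Hb Hdec x y Hx Hy Hxy. unfold tangent_height.
assert (Hdec' := strictly_decreasing_on_closure _ b ovf_continuous_Derive Hdec).
destruct (MVT_Derive V x y Hxy) as [t [Ht Heq]].
- intros t _. apply ovf_ex_derive.
- assert (H1 : Derive V y < Derive V t) by (apply Hdec'; lra).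
  assert (H2 : Derive V y < Derive V x) by (apply Hdec'; lra).
  assert (Derive V y * (y - x) < Derive V t * (y - x)).
  { apply Rmult_lt_compat_r; lra. }
  assert (x * Derive V y < x * Derive V x) by (apply Rmult_lt_compat_l; lra).
  lra.
Qed.

(** * The time gap and its two monotone pieces *)

Definition time_gap (c : R) : R := c / V c.

Lemma time_gap_eq h c : dS < c -> (h * V c = c <-> time_gap c = h).
Proof.
intros Hc. assert (Hp := ovf_pos _ _ HV c Hc). unfold time_gap. split.
- intros H. rewrite <- H at 1. field. lra.
- intros H. rewrite <- H. field. lra.
Qed.

Lemma is_derive_time_gap c :
  dS < c -> is_derive time_gap c (tangent_height c / (V c * V c)).
Proof.
intros Hc. assert (Hp := ovf_pos _ _ HV c Hc). unfold time_gap, tangent_height.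
auto_derive.
- repeat split; [apply ovf_ex_derive|lra].
- change (Derive (fun x => V x) c) with (Derive V c). field. lra.
Qed.

Lemma time_gap_C1 : C1_on (fun c => dS < c) time_gap.
Proof.
intros c Hc. assert (Hp := ovf_pos _ _ HV c Hc).
split; [eexists; apply is_derive_time_gap, Hc|].
apply continuous_ext_loc with (fun x => tangent_height x * / (V x * V x)).
{ generalize (open_gt dS c Hc). apply filter_imp. intros x Hx.
  symmetry. apply is_derive_unique, is_derive_time_gap, Hx. }
apply (continuous_mult tangent_height).
- apply (continuous_minus V); [apply ovf_continuous|].
  apply (continuous_mult (fun x : R => x) (Derive V));
    [apply continuous_id|apply ovf_continuous_Derive].
- apply (continuous_comp (fun x => V x * V x) Rinv).
  + apply (continuous_mult V V); apply ovf_continuous.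
  + apply continuous_Rinv. assert (0 < V c * V c); [|lra].
    apply Rmult_lt_0_compat; exact Hp.
Qed.

Lemma time_gap_Derive_sign c :
  dS < c ->
  (tangent_height c < 0 -> Derive time_gap c < 0) /\
  (0 < tangent_height c -> 0 < Derive time_gap c).
Proof.
intros Hc. rewrite (is_derive_unique _ _ _ (is_derive_time_gap c Hc)).
assert (Hp := ovf_pos _ _ HV c Hc).
assert (Hi : 0 < / (V c * V c)).
{ apply Rinv_0_lt_compat, Rmult_lt_0_compat; exact Hp. }
split; intros H; unfold Rdiv.
- apply Ropp_lt_cancel. rewrite Ropp_0, Ropp_mult_distr_l.
  apply Rmult_lt_0_compat; lra.
- apply Rmult_lt_0_compat; assumption.
Qed.

Lemma MVT_time_gap x y :
  dS < x -> x < y ->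
  exists t, x < t < y /\ time_gap y - time_gap x = Derive time_gap t * (y - x).
Proof.
intros Hx Hxy. apply MVT_Derive; [exact Hxy|].
intros t Ht. apply time_gap_C1. lra.
Qed.

Lemma ovf_equation_continuity h : continuity (fun c => h * V c - c).
Proof.
intros c. apply continuity_pt_filterlim.
apply (continuous_minus (fun x => h * V x) (fun x => x)).
- apply (continuous_scal_r h V), ovf_continuous.
- apply continuous_id.
Qed.

(** Near [dS] the slope of [V] is below [1 / h], because it vanishes at
    [dS]. *)
Lemma ovf_equation_neg_near_dS h u :
  0 < h -> dS < u -> exists x, dS < x < u /\ h * V x < x.
Proof.
intros Hh Hu.
assert (Hl : locally dS (fun s => Derive V s < / h)).
{ apply (ovf_continuous_Derive dS (fun z => z < / h)), open_lt.
  rewrite ovf_Derive_dS. apply Rinv_0_lt_compat, Hh. }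
destruct Hl as [d Hd].
set (x := Rmin (dS + d / 2) ((dS + u) / 2)).
assert (Hdp := cond_pos d).
assert (Hx : dS < x < u /\ x < dS + d).
{ unfold x, Rmin. destruct Rle_dec; lra. }
exists x. split; [apply Hx|].
destruct (MVT_Derive V dS x) as [t [Ht Heq]].
- lra.
- intros t _. apply ovf_ex_derive.
- rewrite (ovf_zero _ _ HV dS) in Heq by lra.
  assert (Hlt : Derive V t < / h).
  { apply Hd. change (Rabs (t - dS) < d). apply Rabs_def1; lra. }
  assert (h * Derive V t < 1).
  { apply Rmult_lt_reg_l with (/ h); [now apply Rinv_0_lt_compat|].
    rewrite <- Rmult_assoc, Rinv_l; lra. }
  assert (h * Derive V t * (x - dS) < 1 * (x - dS)).
  { apply Rmult_lt_compat_r; lra. }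
  assert (Hd0 := ovf_dS_nonneg _ _ HV).
  replace (V x) with (Derive V t * (x - dS)) by lra. lra.
Qed.

(** [h * V] is bounded, the identity is not. *)
Lemma ovf_equation_neg_far h u : 0 < h -> exists x, u < x /\ h * V x < x.
Proof.
intros Hh. destruct (ovf_max _ _ HV) as [M [HM [HVM _]]].
assert (HhM : 0 < h * M) by now apply Rmult_lt_0_compat.
assert (Hu := Rle_abs u). assert (Hu0 := Rabs_pos u).
exists (h * M + Rabs u + 1). split; [lra|].
assert (h * V (h * M + Rabs u + 1) <= h * M).
{ apply Rmult_le_compat_l; [lra|apply HVM]. }
lra.
Qed.

(** * The critical point and the two branches *)

Variables cs hs : R.
Hypotheses (Hcs : 0 < cs) (Hhs : 0 < hs).
Hypotheses (Hsol : hs * V cs = cs) (Hcrit : hs * Derive V cs = 1).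

Lemma critical_V_pos : 0 < V cs.
Proof.
apply Rmult_lt_reg_l with hs; [exact Hhs|]. rewrite Rmult_0_r, Hsol. exact Hcs.
Qed.

Lemma critical_gt_dS : dS < cs.
Proof. apply ovf_pos_inv, critical_V_pos. Qed.

Lemma tangent_height_critical : tangent_height cs = 0.
Proof.
unfold tangent_height. rewrite <- Hsol at 2.
replace (hs * V cs * Derive V cs) with (V cs * (hs * Derive V cs)) by ring.
rewrite Hcrit. ring.
Qed.

Lemma tangent_height_neg c : dS < c < cs -> tangent_height c < 0.
Proof.
intros Hc. destruct (ovf_inflection _ _ HV) as [b [Hb [Hinc Hdec]]].
destruct (Rle_lt_dec c b) as [Hcb|Hcb].
- apply (tangent_height_convex b); [exact Hinc|lra].
- rewrite <- tangent_height_critical.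
  apply (tangent_height_concave b); auto; lra.
Qed.

Lemma tangent_height_pos c : cs < c -> 0 < tangent_height c.
Proof.
intros Hc. destruct (ovf_inflection _ _ HV) as [b [Hb [Hinc Hdec]]].
assert (Hg := critical_gt_dS).
destruct (Rle_lt_dec cs b) as [Hcb|Hcb].
- assert (H := tangent_height_convex b cs Hinc (conj Hg Hcb)).
  rewrite tangent_height_critical in H. lra.
- rewrite <- tangent_height_critical.
  apply (tangent_height_concave b); auto; lra.
Qed.

Lemma time_gap_decreasing : strictly_decreasing_on (fun c => dS < c <= cs) time_gap.
Proof.
intros x y Hx Hy Hxy.
destruct (MVT_time_gap x y) as [t [Ht Heq]]; [lra|exact Hxy|].
assert (Ht0 : Derive time_gap t < 0).
{ apply time_gap_Derive_sign; [lra|]. apply tangent_height_neg. lra. }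
assert (0 < - Derive time_gap t * (y - x)) by (apply Rmult_lt_0_compat; lra).
lra.
Qed.

Lemma time_gap_increasing : strictly_increasing_on (fun c => cs <= c) time_gap.
Proof.
assert (Hg := critical_gt_dS).
intros x y Hx Hy Hxy.
destruct (MVT_time_gap x y) as [t [Ht Heq]]; [lra|exact Hxy|].
assert (Ht0 : 0 < Derive time_gap t).
{ apply time_gap_Derive_sign; [lra|]. apply tangent_height_pos. lra. }
assert (0 < Derive time_gap t * (y - x)) by (apply Rmult_lt_0_compat; lra).
lra.
Qed.

Lemma time_gap_critical : time_gap cs = hs.
Proof. apply time_gap_eq; [exact critical_gt_dS|exact Hsol]. Qed.

Lemma time_gap_left c : dS < c < cs -> hs < time_gap c.
Proof.
intros Hc. rewrite <- time_gap_critical. apply time_gap_decreasing; lra.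
Qed.

Lemma time_gap_right c : cs < c -> hs < time_gap c.
Proof.
intros Hc. rewrite <- time_gap_critical. apply time_gap_increasing; lra.
Qed.

Lemma ovf_equation_pos_critical h : hs < h -> cs < h * V cs.
Proof.
intros Hh. rewrite <- Hsol at 1.
apply Rmult_lt_compat_r; [exact critical_V_pos|exact Hh].
Qed.

Lemma ovf_equation_root h x :
  hs < h -> h * V x < x ->
  exists c, Rmin x cs <= c <= Rmax x cs /\ c <> x /\ c <> cs /\ h * V c = c.
Proof.
intros Hh Hx. assert (Hp := ovf_equation_pos_critical h Hh).
destruct (IVT_gen (fun c => h * V c - c) x cs 0 (ovf_equation_continuity h))
  as [c [Hc Hc0]].
- split.
  + eapply Rle_trans; [apply Rmin_l|]. lra.
  + eapply Rle_trans; [|apply Rmax_r]. lra.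
- exists c. split; [exact Hc|].
  repeat split; try intros ->; lra.
Qed.

Lemma time_gap_left_onto h :
  exists c, hs < h -> (dS < c < cs) /\ time_gap c = h.
Proof.
destruct (Rlt_le_dec hs h) as [Hh|Hh]; [|exists 0; lra].
destruct (ovf_equation_neg_near_dS h cs) as [x [Hx Hneg]];
  [lra|exact critical_gt_dS|].
destruct (ovf_equation_root h x Hh Hneg) as [c [Hc [Ncx [Ncs Heq]]]].
rewrite Rmin_left, Rmax_right in Hc by lra.
exists c. intros _. split; [lra|]. apply time_gap_eq; [lra|exact Heq].
Qed.

Lemma time_gap_right_onto h :
  exists c, hs < h -> cs < c /\ time_gap c = h.
Proof.
destruct (Rlt_le_dec hs h) as [Hh|Hh]; [|exists 0; lra].
assert (Hg := critical_gt_dS).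
destruct (ovf_equation_neg_far h cs) as [x [Hx Hneg]]; [lra|].
destruct (ovf_equation_root h x Hh Hneg) as [c [Hc [Ncx [Ncs Heq]]]].
rewrite Rmin_right, Rmax_left in Hc by lra.
exists c. intros _. split; [lra|]. apply time_gap_eq; [lra|exact Heq].
Qed.

Lemma branch_slope h c :
  dS < c -> time_gap c = h -> tangent_height c <> 0 ->
  / Derive time_gap c = V c / (1 - h * Derive V c).
Proof.
intros Hc Hh Nt. assert (Hp := ovf_pos _ _ HV c Hc).
rewrite (is_derive_unique _ _ _ (is_derive_time_gap c Hc)).
rewrite <- Hh. unfold time_gap. unfold tangent_height in *.
field. repeat split; lra.
Qed.

(** At a solution the tangent height is [V c * (1 - h * V' c)]. *)
Lemma tangent_height_slope h c :
  dS < c -> time_gap c = h ->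
  (tangent_height c < 0 -> 1 < h * Derive V c) /\
  (0 < tangent_height c -> h * Derive V c < 1).
Proof.
intros Hc Hh. assert (Hp := ovf_pos _ _ HV c Hc).
assert (Heq : tangent_height c = V c * (1 - h * Derive V c)).
{ apply time_gap_eq in Hh; [|exact Hc].
  unfold tangent_height. rewrite <- Hh at 2. ring. }
rewrite Heq. split; intros H.
- apply Rnot_le_lt. intros Hle.
  assert (0 <= V c * (1 - h * Derive V c)) by (apply Rmult_le_pos; lra). lra.
- apply Rnot_le_lt. intros Hle.
  assert (0 <= V c * (h * Derive V c - 1)) by (apply Rmult_le_pos; lra). lra.
Qed.

Lemma branch_regularity (D : R -> Prop) (g : R -> R) :
  open D -> (forall c, D c -> dS < c) ->
  (forall c, D c -> tangent_height c <> 0) ->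
  strictly_increasing_on D time_gap \/ strictly_decreasing_on D time_gap ->
  (forall h, hs < h -> D (g h) /\ time_gap (g h) = h) ->
  C1_on (fun h => hs < h) g /\
  forall h, hs < h -> Derive g h = V (g h) / (1 - h * Derive V (g h)).
Proof.
intros OD Dd Dt Mon Hg.
destruct (C1_on_inverse D (fun h => hs < h) time_gap g) as [HC HD]; auto.
- apply open_gt.
- intros c Dc. apply time_gap_C1, Dd, Dc.
- intros c Dc. assert (Hs := time_gap_Derive_sign c (Dd c Dc)).
  destruct (Rdichotomy _ _ (Dt c Dc)) as [H|H]; apply Hs in H; lra.
- split; [exact HC|]. intros h Hh. destruct (Hg h Hh) as [Dc Heq].
  rewrite (HD h Hh). apply branch_slope; auto.
Qed.

End OptimalVelocity.

Theorem theorem3p9 (V : R -> R) (dS : R) (cs hs : R)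
  (HV : optimal_velocity_function V dS)
  (Hcs : 0 < cs) (Hhs : 0 < hs)
  (Hsol : hs * V cs = cs) (Hcrit : hs * Derive V cs = 1) :
  exists (hhat : Rbar) (c1 c2 : R -> R),
    Rbar_lt hs hhat /\
    (forall h, hs < h -> Rbar_lt h hhat -> dS < c1 h < cs) /\
    (forall h, hs < h -> cs < c2 h) /\
    (forall c h, 0 < c -> 0 < h -> (c, h) <> (cs, hs) ->
       (h * V c = c <->
        (hs < h /\ Rbar_lt h hhat /\ c = c1 h) \/ (hs < h /\ c = c2 h))) /\
    C1_on (fun h => hs < h /\ Rbar_lt h hhat) c1 /\
    C1_on (fun h => hs < h) c2 /\
    (forall h, hs < h -> Rbar_lt h hhat ->
       Derive c1 h = V (c1 h) / (1 - h * Derive V (c1 h))) /\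
    (forall h, hs < h ->
       Derive c2 h = V (c2 h) / (1 - h * Derive V (c2 h))) /\
    (forall h, hs < h -> Rbar_lt h hhat -> 1 < h * Derive V (c1 h)) /\
    (forall h, hs < h -> h * Derive V (c2 h) < 1).
Proof.
assert (Hg : dS < cs) by (apply (critical_gt_dS V dS HV cs hs); assumption).
assert (Tneg := tangent_height_neg V dS HV cs hs Hsol Hcrit).
assert (Tpos := tangent_height_pos V dS HV cs hs Hcs Hhs Hsol Hcrit).
assert (Mdec := time_gap_decreasing V dS HV cs hs Hsol Hcrit).
assert (Minc := time_gap_increasing V dS HV cs hs Hcs Hhs Hsol Hcrit).
set (c1 := fun h => proj1_sig (constructive_indefinite_description _
             (time_gap_left_onto V dS HV cs hs Hcs Hhs Hsol h))).
set (c2 := fun h => proj1_sig (constructive_indefinite_description _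
             (time_gap_right_onto V dS HV cs hs Hcs Hhs Hsol h))).
assert (B1 : forall h, hs < h -> (dS < c1 h < cs) /\ time_gap V (c1 h) = h).
{ intros h. unfold c1. now destruct constructive_indefinite_description. }
assert (B2 : forall h, hs < h -> cs < c2 h /\ time_gap V (c2 h) = h).
{ intros h. unfold c2. now destruct constructive_indefinite_description. }
clearbody c1 c2.
destruct (branch_regularity V dS HV hs (fun c => dS < c < cs) c1)
  as [C1 D1]; try assumption.
{ apply open_and; [apply open_gt|apply open_lt]. }
{ intros c Hc. apply Hc. }
{ intros c Hc. apply Rlt_not_eq, Tneg, Hc. }
{ right. intros x y Hx Hy. apply Mdec; lra. }
destruct (branch_regularity V dS HV hs (fun c => cs < c) c2)
  as [C2 D2]; try assumption.
{ apply open_gt. }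
{ intros c Hc. lra. }
{ intros c Hc. apply Rgt_not_eq, Tpos, Hc. }
{ left. intros x y Hx Hy. apply Minc; lra. }
exists p_infty, c1, c2.
split; [exact I|].
split; [intros h Hh _; apply B1, Hh|].
split; [intros h Hh; apply B2, Hh|].
split.
{ intros c h Hc Hh Hne. split.
  - intros Heq.
    assert (HdS : dS < c).
    { apply (ovf_pos_inv V dS HV). apply Rmult_lt_reg_l with h; [exact Hh|].
      rewrite Rmult_0_r, Heq. exact Hc. }
    apply (time_gap_eq V dS HV h c HdS) in Heq.
    destruct (Rtotal_order c cs) as [Hl|[He|Hr]].
    + left.
      assert (Hhh : hs < h).
      { rewrite <- Heq.
        apply (time_gap_left V dS HV cs hs); auto. }
      split; [exact Hhh|]. split; [exact I|].
      destruct (B1 h Hhh) as [Hb Hb'].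
      destruct (Rtotal_order c (c1 h)) as [H|[H|H]]; [|exact H|];
        apply Mdec in H; lra.
    + exfalso. apply Hne. rewrite <- Heq, He.
      now rewrite (time_gap_critical V dS HV cs hs).
    + right.
      assert (Hhh : hs < h).
      { rewrite <- Heq.
        apply (time_gap_right V dS HV cs hs); auto. }
      split; [exact Hhh|].
      destruct (B2 h Hhh) as [Hb Hb'].
      destruct (Rtotal_order c (c2 h)) as [H|[H|H]]; [|exact H|];
        apply Minc in H; lra.
  - intros [[Hhh [_ ->]]|[Hhh ->]].
    + destruct (B1 h Hhh) as [Hb Hb']. apply (time_gap_eq V dS HV); [lra|auto].
    + destruct (B2 h Hhh) as [Hb Hb']. apply (time_gap_eq V dS HV); [lra|auto]. }
split; [intros h [Hh _]; apply C1, Hh|].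
split; [exact C2|].
split; [intros h Hh _; apply D1, Hh|].
split; [exact D2|].
split.
- intros h Hh _. destruct (B1 h Hh) as [Hb Hb'].
  apply (tangent_height_slope V dS HV h (c1 h)); auto; lra.
- intros h Hh. destruct (B2 h Hh) as [Hb Hb'].
  apply (tangent_height_slope V dS HV h (c2 h)); auto; lra.
Qed.
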